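(* For every $m\geq 3$ and every positive integer $r$, $\operatorname{im}(C_m\times K_r)=2r-1$.
   Context: All graphs are finite and simple. $C_m$ is the cycle on $m$ vertices and $K_r$ the complete graph on $r$ vertices. A graph $G$ has a $G'$-immersion if there is an injective map $\phi:V(G')\to V(G)$ such that for every edge $uv\in E(G')$ there is a path in $G$ joining $\phi(u)$ and $\phi(v)$, and these paths are pairwise edge-disjoint. The immersion number $\operatorname{im}(G)$ is the largest $t$ such that $G$ has a $K_t$-immersion. The direct product $G\times H$ has vertex set $V(G)\times V(H)$, with $(g,h)$ adjacent to $(g',h')$ iff $gg'\in E(G)$ and $hh'\in E(H)$. *)

(* Defs.v *)
From HB Require Import structures.
From mathcomp Require Import all_boot.
From mathcomp Require Import boolp.

Set Implicit Arguments.
Unset Strict Implicit.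
Unset Printing Implicit Defensive.

Record sgraph := SGraph {
  vertex :> finType;
  adj : rel vertex;
  adj_sym : symmetric adj;
  adj_irrefl : irreflexive adj }.

Definition edge_set (G : sgraph) : {set {set G}} :=
  [set [set p.1; p.2] | p : G * G & adj p.1 p.2].

Definition complete_adj (r : nat) : rel 'I_r := fun i j => i != j.

Lemma complete_adj_sym r : symmetric (@complete_adj r).
Proof. by move=> i j; rewrite /complete_adj eq_sym. Qed.

Lemma complete_adj_irrefl r : irreflexive (@complete_adj r).
Proof. by move=> i; rewrite /complete_adj eqxx. Qed.

Definition complete_graph (r : nat) : sgraph :=
  SGraph (@complete_adj_sym r) (@complete_adj_irrefl r).

(* The condition [i != j] only matters for m = 1, where it excludes a loop. *)
Definition cycle_adj (m : nat) : rel 'I_m :=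
  fun i j => (i != j) && ((i.+1 %% m == j) || (j.+1 %% m == i)).

Lemma cycle_adj_sym m : symmetric (@cycle_adj m).
Proof. by move=> i j; rewrite /cycle_adj eq_sym orbC. Qed.

Lemma cycle_adj_irrefl m : irreflexive (@cycle_adj m).
Proof. by move=> i; rewrite /cycle_adj eqxx. Qed.

Definition cycle_graph (m : nat) : sgraph :=
  SGraph (@cycle_adj_sym m) (@cycle_adj_irrefl m).

Section DirectProduct.
Variables G H : sgraph.

Definition direct_adj : rel (G * H) :=
  fun x y => adj x.1 y.1 && adj x.2 y.2.

Lemma direct_adj_sym : symmetric direct_adj.
Proof. by move=> x y; rewrite /direct_adj adj_sym (adj_sym x.2). Qed.

Lemma direct_adj_irrefl : irreflexive direct_adj.
Proof. by move=> x; rewrite /direct_adj adj_irrefl. Qed.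

Definition direct_product : sgraph := SGraph direct_adj_sym direct_adj_irrefl.
End DirectProduct.

(* A path is given by the list of all its vertices, in either direction. *)
Definition path_joins (G : sgraph) (x y : G) (p : seq G) : bool :=
  if p is z :: q
  then [&& path (@adj G) z q, uniq p & [set z; last z q] == [set x; y]]
  else false.

Definition path_edges (G : sgraph) (p : seq G) : seq {set G} :=
  if p is z :: q then pairmap (fun a b => [set a; b]) z q else [::].

(* [P e] is the path of G assigned to the edge e of G'; the values of P on sets
   that are not edges of G' are irrelevant. *)
Definition has_immersion (G' G : sgraph) : Prop :=
  exists (phi : G' -> G) (P : {set G'} -> seq G),
    [/\ injective phi,
        forall u v : G', adj u v -> path_joins (phi u) (phi v) (P [set u; v])
      & forall e f : {set G'}, e \in edge_set G' -> f \in edge_set G' ->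
          e != f -> [disjoint path_edges (P e) & path_edges (P f)]].

(* The bound t <= #|G| loses nothing since phi is injective: see
   [immersion_numberP]. *)
Definition immersion_number (G : sgraph) : nat :=
  \max_(t < #|G|.+1 | `[< has_immersion (complete_graph t) G >]) t.

Lemma immersion_numberP (G : sgraph) :
  has_immersion (complete_graph (immersion_number G)) G /\
  forall t, has_immersion (complete_graph t) G -> t <= immersion_number G.
Proof.
split=> [|t imt].
  have im0 : `[< has_immersion (complete_graph (@ord0 #|G|)) G >].
    apply/asboolP; exists (fun i : 'I_0 => match notF (ltn_ord i) with end).
    exists (fun=> [::]); split; try by case.
    by move=> e f /imsetP[[[]]].
  rewrite /immersion_number (bigmax_eq_arg _ im0).
  by case: arg_maxnP => // i /asboolP.
have ltG : t < #|G|.+1.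
  case: imt => phi [P [phi_inj _ _]].
  by have := leq_card phi phi_inj; rewrite /= card_ord ltnS.
by apply: (bigmax_sup (Ordinal ltG)) => //; apply/asboolP.
Qed.

(* Main.v *)
Require Import Defs.
From mathcomp Require Import all_boot.
From mathcomp Require Import all_algebra.
From mathcomp Require Import boolp zify.

(** The graph is regular of degree [2 (r - 1)], and the paths leaving a branch
vertex of a [K_t]-immersion start with distinct edges, so [t <= 2 r - 1].

For the lower bound let [c, a, b, d] be consecutive layers of [C_m x K_r] (with
[c = d] when [m = 3]), and take as branch vertices all [a_i] and all [b_i]
except one, [b_oo]. The pairs [a_i b_j] with [i <> j] are edges.

If [r] is odd, index by [Z_r] with [oo = 0]; the paths [a_i c_k a_j] and
[b_i d_k b_j] with [2 k = i + j] are edge-disjoint, and prolonging the second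
one for [j = oo] by the edge [b_oo a_i] joins [a_i] to [b_i].

If [r] is even, index by [Z_(r-1)] together with [oo], and use midpoints for
pairs of finite indices. For [m = 3] the remaining paths are [a_i c_oo b_i] and
[a_k b_oo c_k a_oo]. For [m = 4] and [r > 2], fix [u <> 0]; they are
[a_i c_oo d_(i-u) c_i d_oo b_i] and [a_oo c_k d_(k+u) b_oo a_(k+u)]. For [m = 4]
and [r = 2] use a 4-cycle. Finally [C_m x K_r] is immersed in
[C_(m+2) x K_r]: an edge [x_i y_j] between two fixed layers becomes
[x_i p_j q_i y_j] through the two new layers.

Edge-disjointness is encoded by labelling every edge with the pair of branch
vertices whose path it may belong to. *)

Set Implicit Arguments.
Unset Strict Implicit.
Unset Printing Implicit Defensive.
Import GRing.Theory.

(** * Upper bound from vertex degrees *)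

Lemma set2_inj (T : finType) (a b c d : T) :
  [set a; b] = [set c; d] -> (a = c /\ b = d) \/ (a = d /\ b = c).
Proof.
move=> E.
have ha : a \in [set c; d] by rewrite -E set21.
have hb : b \in [set c; d] by rewrite -E set22.
have hc : c \in [set a; b] by rewrite E set21.
have hd : d \in [set a; b] by rewrite E set22.
move: ha hb hc hd; rewrite !inE.
do 4![case/orP=> /eqP ?]; subst; by [left | right].
Qed.

(** Since [path_joins] allows both directions, [x] is the first or the last vertex of [p];
    accordingly the first or the last edge is taken. *)
Lemma path_edge_at_end (G : sgraph) (x y : G) (p : seq G) :
  x != y -> path_joins x y p ->
  exists w, adj x w /\ [set x; w] \in path_edges p.
Proof.
case: p => [//|z q] neq_xy /= /and3P[pth _ /eqP/set2_inj ends].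
case: ends pth => [[-> lastE]|[zy lastE]].
  case: q lastE => [/= lastE|w q _ /= /andP[xw _]].
    by rewrite lastE eqxx in neq_xy.
  by exists w; rewrite mem_head.
case/lastP: q lastE => [/= zx|q l].
  by rewrite -zx zy eqxx in neq_xy.
rewrite last_rcons => ->; rewrite rcons_path => /andP[_ wx].
exists (last z q); rewrite adj_sym; split=> //.
by rewrite -cats1 pairmap_cat /= mem_cat mem_seq1 setUC eqxx orbT.
Qed.

Lemma immersion_degree_bound (G : sgraph) (t d : nat) :
  (forall x : G, #|[set y | adj x y]| <= d) ->
  has_immersion (complete_graph t.+1) G -> t <= d.
Proof.
move=> degG [phi [P [phi_inj Pjoin Pdisj]]].
pose e (v : 'I_t) : {set 'I_t.+1} := [set ord0; lift ord0 v].
have adj0 v : adj (ord0 : complete_graph t.+1) (lift ord0 v) by [].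
have eE v : e v \in edge_set (complete_graph t.+1).
  by apply/imsetP; exists (ord0, lift ord0 v); rewrite // inE.
have /choice[w wP] v : exists w,
    adj (phi ord0) w /\ [set phi ord0; w] \in path_edges (P (e v)).
  by apply: path_edge_at_end (Pjoin _ _ (adj0 v)); rewrite (inj_eq phi_inj).
have w_inj : injective w.
  (* Two paths with the same neighbour of [phi ord0] would share the edge to it. *)
  move=> v v' eqw; apply/eqP; apply: contraT => neq.
  have neqe : e v != e v'.
    apply: contra neq => /eqP/set2_inj[[_ /lift_inj ->]//|[]].
    by move/eqP; rewrite (negPf (neq_lift _ _)).
  have /pred0P/(_ [set phi ord0; w v]) := Pdisj _ _ (eE v) (eE v') neqe.
  by rewrite /= (wP v).2 eqw (wP v').2.
rewrite -[t]card_ord -(card_imset _ w_inj).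
apply: leq_trans (degG (phi ord0)); apply: subset_leq_card.
by apply/subsetP=> _ /imsetP[v _ ->]; rewrite inE; case: (wP v).
Qed.

Lemma cycle_degree (m : nat) (i : 'I_m) : #|[set j | cycle_adj i j]| <= 2.
Proof.
case: m i => [[]//|m] i.
pose s : 'I_m.+1 := inord (i.+1 %% m.+1).
(* The predecessor of [i]: adding [m] subtracts 1 modulo [m.+1]. *)
pose p : 'I_m.+1 := inord ((i + m) %% m.+1).
apply: (@leq_trans #|[set s; p]|); last by rewrite cards2; case: (s != p).
apply: subset_leq_card; apply/subsetP=> j.
rewrite !inE => /andP[_ /orP[] /eqP eqj]; apply/orP; [left|right].
  by rewrite -val_eqE /= inordK ?eqj // ltn_mod.
rewrite -val_eqE /= inordK ?ltn_mod // -eqj modnDml addSnnS modnDr.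
by rewrite modn_small.
Qed.

Lemma cycle_complete_degree (m r : nat)
  (x : direct_product (cycle_graph m) (complete_graph r)) :
  #|[set y | adj x y]| <= 2 * r.-1.
Proof.
have -> : [set y | adj x y] =
    setX [set j | cycle_adj x.1 j] [set k | complete_adj x.2 k].
  by apply/setP=> y; rewrite !inE.
rewrite cardsX leq_mul ?cycle_degree //.
have -> : [set k | complete_adj x.2 k] = [set~ x.2].
  by apply/setP=> k; rewrite !inE eq_sym.
by rewrite cardsC1 card_ord.
Qed.

(** * Immersions from edge labellings *)

Definition labelled (G : sgraph) (lab : G -> G -> {set G}) (e : {set G}) :
    rel G :=
  [rel x y | adj x y && (lab x y == e)].

(** No disjointness has to be stated: an edge carries a single label, so walks for different pairs,
    using different labels, cannot share it. Symmetry makes [lab] a function of the undirected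
    edge. *)
Definition clique_routing (G : sgraph) (B : {set G})
    (lab : G -> G -> {set G}) : Prop :=
  (forall x y, lab x y = lab y x) /\
  {in B &, forall x y, x != y -> connect (labelled lab [set x; y]) x y}.

Lemma labelled_path_edges (G : sgraph) (lab : G -> G -> {set G}) e x p F :
  path (labelled lab e) x p -> F \in path_edges (x :: p) ->
  exists a b, F = [set a; b] /\ lab a b = e.
Proof.
elim: p x => [//|y p IHp] x /= /andP[/andP[_ /eqP labxy] pth].
rewrite inE => /orP[/eqP -> |/(IHp y pth)//]; by exists x, y.
Qed.

Lemma routing_immersion (G : sgraph) (B : {set G}) lab :
  clique_routing B lab -> has_immersion (complete_graph #|B|) G.
Proof.
case=> labC conB; pose phi : 'I_#|B| -> G := enum_val.
have phi_inj : injective phi by exact: enum_val_inj.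
have imE u v : phi @: [set u; v] = [set phi u; phi v].
  by rewrite imsetU1 imset_set1.
(* The path is chosen for the unordered pair [e], so it has to serve both orders of its
   endpoints. *)
have /choice[P PP] (e : {set 'I_#|B|}) : exists p,
    e \in edge_set (complete_graph #|B|) ->
    (forall u v, e = [set u; v] -> path_joins (phi u) (phi v) p) /\
    (forall F, F \in path_edges p ->
       exists a b, F = [set a; b] /\ lab a b = phi @: e).
  case: (boolP (e \in edge_set (complete_graph #|B|))); last by exists [::].
  case/imsetP=> -[u v].
  rewrite inE /= => neq ->.
  have /connectP[p pth lastE] :
      connect (labelled lab [set phi u; phi v]) (phi u) (phi v).
    by apply: conB; rewrite ?(inj_eq phi_inj) //; apply: enum_valP.
  (* Connectivity only yields a walk, while [path_joins] demands distinct vertices. *)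
  case/shortenP: pth lastE => q pth uq _ lastE.
  exists (phi u :: q) => _; split=> [u' v' eqe|F /labelled_path_edges].
    rewrite /path_joins uq -lastE -!imE eqe eqxx !andbT.
    by apply: sub_path pth => a b /andP[].
  by rewrite imE; apply.
exists phi, P; split=> // [u v uv|e f eE fE neq].
  apply: (proj1 (PP _ _)) => //.
  by apply/imsetP; exists (u, v); rewrite // inE.
apply/pred0P=> F /=; apply/negP=> /andP[Fe Ff].
have [a [b [FE labe]]] := (PP e eE).2 F Fe.
have [c [d [/esym FE' labf]]] := (PP f fE).2 F Ff.
case/eqP: neq; apply: (imset_inj phi_inj); rewrite -labe -labf.
by move: FE'; rewrite FE => /set2_inj[] [-> ->].
Qed.

Lemma connect_labelledC (G : sgraph) (lab : G -> G -> {set G}) e :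
  (forall x y, lab x y = lab y x) ->
  connect_sym (labelled lab e).
Proof.
move=> labC; apply: sym_connect_sym => x y.
by rewrite /labelled /= adj_sym labC.
Qed.

(* Every edge of G1 becomes a path of G2 all of whose edges f folds back onto
   it, so pulling the labels back along f keeps distinct labels apart. *)
Lemma fold_routing (G1 G2 : sgraph) (f : G2 -> G1) (g : G1 -> G2) B lab :
  injective g ->
  (forall x y : G1, adj x y ->
     connect [rel a b | adj a b && ([set f a; f b] == [set x; y])]
       (g x) (g y)) ->
  clique_routing B lab ->
  clique_routing (g @: B) (fun a b => g @: lab (f a) (f b)).
Proof.
move=> g_inj lift_edge [labC conB]; split=> [x y|]; first by rewrite labC.
move=> _ _ /imsetP[x xB ->] /imsetP[y yB ->]; rewrite (inj_eq g_inj) => neq.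
have /connectP[p pth yE] := conB x y xB yB neq.
have -> : [set g x; g y] = g @: [set x; y] by rewrite imsetU1 imset_set1.
(* The label stays fixed during the induction while the start of the walk moves. *)
move: [set x; y] pth => e; rewrite yE {y yB yE xB neq}.
elim: p x => [|z p IHp] x /=; first by rewrite connect0.
case/andP=> /andP[xz /eqP labxz] /IHp; apply: connect_trans.
have := lift_edge x z xz; apply: connect_sub => a b /= /andP[ab /eqP/set2_inj].
move=> fab; apply: connect1; rewrite /labelled /= ab /=.
by case: fab => [] [-> ->]; rewrite ?(labC z) labxz.
Qed.

(** * Lengthening the cycle by two layers *)

Notation cycle_complete m r :=
  (direct_product (cycle_graph m) (complete_graph r)).

Lemma cycle_adjP (m : nat) (i j : 'I_m) : cycle_adj i j ->
  [\/ i.+1 = j, j.+1 = i, i.+1 = m /\ j = 0 :> nat | j.+1 = m /\ i = 0 :> nat].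
Proof.
have modS (k : 'I_m) : k.+1 %% m = if k.+1 == m then 0 else k.+1.
  have := ltn_ord k; case: eqP => [-> _|? ?]; first by rewrite modnn.
  by rewrite modn_small //; lia.
case/andP=> _; rewrite !modS.
by case/orP; case: ifP => /eqP Em /eqP Eij;
  [constructor 3 | constructor 1 | constructor 4 | constructor 2].
Qed.

Lemma cycle_adj_succ (m : nat) (i j : 'I_m) :
  i.+1 = j :> nat -> cycle_adj i j.
Proof.
move=> ij; rewrite /cycle_adj ij modn_small // eqxx andbT -val_eqE /= -ij.
by rewrite neq_ltn ltnSn.
Qed.

Lemma cycle_adj_wrap (m : nat) (i j : 'I_m) :
  1 < m -> i.+1 = m -> j = 0 :> nat -> cycle_adj i j.
Proof.
move=> m_gt1 im j0; rewrite /cycle_adj im modnn j0 eqxx andbT -val_eqE /= j0.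
by rewrite -lt0n; lia.
Qed.

Section Fold.
Variables m r : nat.
Hypothesis m_gt2 : 2 < m.

Local Notation G1 := (cycle_complete m r).
Local Notation G2 := (cycle_complete m.+2 r).

Let m_gt0 : 0 < m. Proof. lia. Qed.
Let m1_lt : m.-1 < m. Proof. lia. Qed.

(** The new layers [m] and [m.+1] are inserted between [m.-1] and 0. They fold crosswise, [m] onto 0
    and [m.+1] onto [m.-1], so that the path [m.-1], [m], [m.+1], 0 runs three times over one
    edge. *)
Definition fold_layer (l : 'I_m.+2) : 'I_m :=
  if insub (val l) is Some k then k
  else if l == m :> nat then Ordinal m_gt0 else Ordinal m1_lt.

Definition fold_vertex (x : G2) : G1 := (fold_layer x.1, x.2).

Definition unfold_vertex (x : G1) : G2 :=
  (widen_ord (leqW (leqnSn m)) x.1, x.2).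

Lemma unfold_vertexK : cancel unfold_vertex fold_vertex.
Proof. by case=> l i; rewrite /fold_vertex /fold_layer /= valK. Qed.

Lemma lift_edge_fold (x y : G1) : adj x y ->
  connect [rel a b : G2 | adj a b &&
            ([set fold_vertex a; fold_vertex b] == [set x; y])]
    (unfold_vertex x) (unfold_vertex y).
Proof.
have sym e : connect_sym
    [rel a b : G2 | adj a b && ([set fold_vertex a; fold_vertex b] == e)].
  by apply: sym_connect_sym => a b; rewrite /= direct_adj_sym setUC.
have consec (u v : G1) : u.1.+1 = v.1 -> u.2 != v.2 ->
    connect [rel a b : G2 | adj a b &&
              ([set fold_vertex a; fold_vertex b] == [set u; v])]
      (unfold_vertex u) (unfold_vertex v).
  move=> uv1 uv2; apply: connect1; rewrite /= !unfold_vertexK eqxx andbT.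
  by rewrite /direct_adj /= /complete_adj uv2 andbT cycle_adj_succ.
have wrap (u v : G1) : u.1.+1 = m -> v.1 = 0 :> nat -> u.2 != v.2 ->
    connect [rel a b : G2 | adj a b &&
              ([set fold_vertex a; fold_vertex b] == [set u; v])]
      (unfold_vertex u) (unfold_vertex v).
  move=> u1 v1 uv2.
  have mS : m < m.+2 by lia.
  have m1S : m.+1 < m.+2 by lia.
  (* The path [u], [p], [q], [v] folds to [u], [v], [u], [v]; its second coordinates alternate and
     hence always differ. *)
  pose p : G2 := (Ordinal mS, v.2); pose q : G2 := (Ordinal m1S, u.2).
  have fp : fold_vertex p = v.
    case: v v1 @p {uv2} => l j /= l0; rewrite /fold_vertex /fold_layer /=.
    by rewrite insubF ?ltnn //= eqxx; congr pair; apply: val_inj.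
  have fq : fold_vertex q = u.
    case: u u1 @q {uv2} => l j /= lm; rewrite /fold_vertex /fold_layer /=.
    rewrite insubF ?ltnNge ?leqnSn //= eqn_leq ltnn; congr pair.
    by apply: val_inj => /=; lia.
  have vu2 : v.2 != u.2 by rewrite eq_sym.
  apply: (connect_trans (y := p)); last apply: (connect_trans (y := q)).
  - apply: connect1; rewrite /= unfold_vertexK fp eqxx andbT.
    by rewrite /direct_adj /= /complete_adj uv2 andbT cycle_adj_succ.
  - apply: connect1; rewrite /= fq fp setUC eqxx andbT.
    by rewrite /direct_adj /= /complete_adj vu2 andbT cycle_adj_succ.
  - apply: connect1; rewrite /= unfold_vertexK fq eqxx andbT.
    by rewrite /direct_adj /= /complete_adj uv2 andbT cycle_adj_wrap.
case/andP=> /cycle_adjP xy1 xy2; have yx2 : y.2 != x.2 by rewrite eq_sym.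
case: xy1 => [xy1|yx1|[x1 y1]|[y1 x1]].
- exact: consec.
- by rewrite sym [ [set x; y] ]setUC; apply: consec.
- exact: wrap.
- by rewrite sym [ [set x; y] ]setUC; apply: wrap.
Qed.

Lemma routing_cycle_add2 (B : {set G1}) lab : clique_routing B lab ->
  exists (B' : {set G2}) lab', #|B'| = #|B| /\ clique_routing B' lab'.
Proof.
move=> rB; have uinj := can_inj unfold_vertexK.
exists (unfold_vertex @: B).
exists (fun a b => unfold_vertex @: lab (fold_vertex a) (fold_vertex b)).
split; first by rewrite card_imset.
by apply: fold_routing => //; apply: lift_edge_fold.
Qed.

End Fold.

Lemma routing_cycle_add_even (m r k : nat)
    (B : {set cycle_complete m r}) lab : 2 < m -> clique_routing B lab ->
  exists (B' : {set cycle_complete (k.*2 + m) r}) lab',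
    #|B'| = #|B| /\ clique_routing B' lab'.
Proof.
move=> m_gt2 rB; elim: k => [|k [B' [lab' [cardB' rB']]]].
  by exists B, lab.
have m'_gt2 : 2 < k.*2 + m by lia.
have [B2 [lab2 [cardB2 rB2]]] := routing_cycle_add2 m'_gt2 rB'.
by exists B2, lab2; rewrite cardB2.
Qed.

(** * Halving in cyclic groups of odd order *)

Section OddCyclic.
Variable p : nat.
Hypothesis p_even : ~~ odd p.
Local Open Scope ring_scope.

Lemma ord_mulrS (x : 'I_p.+1) : x *+ p.+1 = 0.
Proof. by rewrite Zp_mulrn; apply: val_inj; rewrite /= modnMl. Qed.

Lemma ord_half (x : 'I_p.+1) : exists k, k + k = x.
Proof.
(* As [p] is even, [p./2.+1] is the inverse of 2 modulo [p.+1]. *)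
exists (x *+ p./2.+1); rewrite -mulrnDr addnn doubleS even_halfK //.
by rewrite mulrS ord_mulrS addr0.
Qed.

Lemma ord_midpoint (i j : 'I_p.+1) : i != j ->
  exists k, [/\ k + k = i + j, i != k & j != k].
Proof.
move=> ij; have [k kk] := ord_half (i + j); exists k; split=> //.
  by apply: contra ij => /eqP ik; rewrite -ik in kk; rewrite (addrI i kk).
by apply: contra ij => /eqP jk; rewrite -jk in kk; rewrite (addIr j kk).
Qed.

Lemma ord_double_inj : injective (fun x : 'I_p.+1 => x + x).
Proof.
move=> x y /= eq2.
(* The term [z *+ p.+1] vanishes, so [z] is determined by [z + z]. *)
have half (z : 'I_p.+1) : z = z *+ p.+1 - (z + z) *+ p./2.
  by rewrite -mulr2n -mulrnA mul2n even_halfK // mulrS addrK.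
by rewrite (half x) (half y) eq2 !ord_mulrS.
Qed.

End OddCyclic.

(** * Consecutive layers and branch vertices *)

Section TwoLayers.
Variables m r : nat.
Local Notation G := (cycle_complete m.+3 r).

(* The layers in cyclic order are c, a, b, d; c and d coincide for m = 0. *)
Definition va (i : 'I_r) : G := (ord0, i).
Definition vb (i : 'I_r) : G := (@Ordinal m.+3 1 isT, i).
Definition vd (i : 'I_r) : G := (@Ordinal m.+3 2 isT, i).
Definition vc (i : 'I_r) : G := (ord_max, i).

Lemma adj_ab i j : i != j -> adj (va i) (vb j).
Proof. by move=> ij; apply/andP; split=> //; apply: cycle_adj_succ. Qed.

Lemma adj_bd i j : i != j -> adj (vb i) (vd j).
Proof. by move=> ij; apply/andP; split=> //; apply: cycle_adj_succ. Qed.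

Lemma adj_ca i j : i != j -> adj (vc i) (va j).
Proof. by move=> ij; apply/andP; split=> //; apply: cycle_adj_wrap. Qed.

(** Symmetrizes [o], which need only be specified from the lower to the higher layer number. The
    default [set0] concerns pairs inside one layer, which are never adjacent. *)
Definition layered_label (o : G -> G -> {set G}) (x y : G) : {set G} :=
  if x.1 < y.1 then o x y else if y.1 < x.1 then o y x else set0.

Lemma layered_labelC o x y : layered_label o x y = layered_label o y x.
Proof. by rewrite /layered_label; case: ltngtP. Qed.

Definition branch (oo : 'I_r) : {set G} :=
  [set va i | i : 'I_r] :|: [set vb i | i in [set~ oo]].

Lemma card_branch oo : #|branch oo| = 2 * r - 1.
Proof.
have va_inj : injective va by move=> i j [].
have vb_inj : injective vb by move=> i j [].
rewrite cardsU !card_imset // cardsC1 !card_ord.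
rewrite [X in #|pred_of_set X|](_ : _ = set0) ?cards0.
  by case: r oo => [[]|//]; lia.
apply/setP=> x; rewrite !inE; apply/negP=> /andP[].
by case/imsetP=> i _ -> /imsetP[].
Qed.

Lemma branch_routing (oo : 'I_r) o (lab := layered_label o) :
  (forall i j, i != j ->
     connect (labelled lab [set va i; va j]) (va i) (va j)) ->
  (forall i j, j != oo ->
     connect (labelled lab [set va i; vb j]) (va i) (vb j)) ->
  (forall i j, i != oo -> j != oo -> i != j ->
     connect (labelled lab [set vb i; vb j]) (vb i) (vb j)) ->
  clique_routing (branch oo) lab.
Proof.
move=> aa ab bb; have labC x y : lab x y = lab y x := layered_labelC o x y.
split=> // x y; rewrite !inE.
case/orP=> /imsetP[i hi ->]; case/orP=> /imsetP[j hj ->] neq.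
- by apply: aa; apply: contra neq => /eqP ->.
- by apply: ab; rewrite !inE in hj.
- by rewrite setUC connect_labelledC //; apply: ab; rewrite !inE in hi.
- by rewrite !inE in hi hj; apply: bb.
Qed.

End TwoLayers.

(** * Routing for odd r *)

Section OddRouting.
Variables m p : nat.
Hypothesis p_even : ~~ odd p.
Local Notation G := (cycle_complete m.+3 p.+1).
Local Notation a := (@va m p.+1).
Local Notation b := (@vb m p.+1).
Local Notation c := (@vc m p.+1).
Local Notation d := (@vd m p.+1).
Local Open Scope ring_scope.

(** The index [j + j - i] is the reflection of [i] in the midpoint [j], that is, the other end of
    the path. An end at [b 0] is not a branch vertex: edges [a i], [b 0] and paths between [b 0] and
    [b i] are both given to the pair [a i], [b i]. *)
Definition odd_orient (x y : G) : {set G} :=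
  let: (lx, i) := x in let: (ly, j) := y in
  if lx == 0%N :> nat then
    if ly == 1%N :> nat then [set a i; b (if j == 0 then i else j)]
    else [set a i; a (j + j - i)]
  else if (i == 0) || (j + j == i) then [set a (j + j); b (j + j)]
  else [set b i; b (j + j - i)].

Local Notation lab := (layered_label odd_orient).
Local Notation con e := (connect (labelled lab e)).

Lemma odd_ab i j : i != j ->
  con [set a i; b (if j == 0 then i else j)] (a i) (b j).
Proof.
by move=> ij; apply: connect1; apply/andP; split=> //; apply: adj_ab.
Qed.

Lemma odd_ac i k : i != k -> con [set a i; a (k + k - i)] (a i) (c k).
Proof.
move=> ik; apply: connect1; apply/andP; split=> //.
by rewrite adj_sym adj_ca // eq_sym.
Qed.

Lemma odd_bd i k : i != k ->
  con (if (i == 0) || (k + k == i) then [set a (k + k); b (k + k)]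
       else [set b i; b (k + k - i)]) (b i) (d k).
Proof.
move=> ik; apply: connect1; apply/andP; split=> //; exact: adj_bd.
Qed.

Lemma odd_routing : clique_routing (branch m 0) lab.
Proof.
have labC x y : lab x y = lab y x := layered_labelC odd_orient x y.
apply: branch_routing => [i j ij|i j j0|i j i0 j0 ij].
- have [k [kk ik jk]] := ord_midpoint p_even ij.
  apply: (connect_trans (y := c k)).
    by have := odd_ac ik; rewrite kk addrAC subrr add0r.
  rewrite connect_labelledC // setUC.
  by have := odd_ac jk; rewrite kk addrK.
- have [ij|ij] := eqVneq i j; last first.
    by have := odd_ab ij; rewrite (negPf j0).
  move: j0; rewrite -ij => i0 {j ij}.
  (* With [k] half of [i], the path is [a i], [b 0], [d k], [b i]. *)
  have [k kk] := ord_half p_even i.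
  have k0 : k != 0 by apply: contra i0 => /eqP k0; rewrite -kk k0 addr0.
  have ik : i != k.
    by apply: contra k0 => /eqP ik; rewrite -(inj_eq (addrI k)) kk ik addr0.
  apply: (connect_trans (y := b 0)).
    by have := odd_ab i0; rewrite eqxx.
  apply: (connect_trans (y := d k)).
    by have := @odd_bd 0 k; rewrite eqxx kk /= eq_sym => /(_ k0).
  rewrite connect_labelledC //.
  by have := odd_bd ik; rewrite kk eqxx orbT.
- have [k [kk ik jk]] := ord_midpoint p_even ij.
  apply: (connect_trans (y := d k)).
    have := odd_bd ik; rewrite (negPf i0) kk addrAC subrr add0r.
    (* Here [k + k == i] would force [j = 0], so the exceptional label does not apply. *)
    by rewrite -[X in _ == X]addr0 (inj_eq (addrI i)) (negPf j0).
  rewrite connect_labelledC // setUC.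
  have := odd_bd jk; rewrite (negPf j0) kk addrK.
  by rewrite -[X in _ == X]add0r (inj_eq (addIr j)) (negPf i0).
Qed.
End OddRouting.

(** * Routing for even r *)

Section EvenRouting.
Variables m p : nat.
Hypothesis p_even : ~~ odd p.
(** The shift between the finite indices in the layers c and d: 0 for the triangle, where these
    layers coincide, and nonzero for the 4-cycle. *)
Variable u : 'I_p.+1.
Local Notation G := (cycle_complete m.+3 p.+2).
Local Notation a := (@va m p.+2).
Local Notation b := (@vb m p.+2).
Local Notation c := (@vc m p.+2).
Local Notation d := (@vd m p.+2).
Local Notation oo := (@ord_max p.+1).
Local Notation fin := (lift oo).
Local Open Scope ring_scope.

(** The default 0 at [oo] enters no label, since [even_orient] first separates the cases with
    [oo]. *)
Definition finpart (i : 'I_p.+2) : 'I_p.+1 := odflt 0 (unlift oo i).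

(* Labels for pairs listed from the lower to the higher layer; the last case is
   only reached between d and c when the cycle has length 4. *)
Definition even_orient (x y : G) : {set G} :=
  let: (lx, i) := x in let: (ly, j) := y in
  let refl := fin (finpart j + finpart j - finpart i) in
  if lx == 0%N :> nat then
    if ly == 1%N :> nat then if j == oo then [set a i; a oo] else [set a i; b j]
    else if j == oo then [set a i; b i]
    else if i == oo then [set a oo; a (fin (finpart j + u))]
    else [set a i; a refl]
  else if lx == 1%N :> nat then
    if i == oo then [set a oo; a j]
    else if j == oo then [set a i; b i]
    else [set b i; b refl]
  else
    if i == oo then [set a j; b j]
    else if j == oo then
      [set a (fin (finpart i + u)); b (fin (finpart i + u))]
    else if finpart i == finpart j + u then [set a oo; a i]
    else [set a j; b j].

Local Notation lab := (layered_label even_orient).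
Local Notation con e := (connect (labelled lab e)).

Lemma finK x : finpart (fin x) = x.
Proof. by rewrite /finpart liftK. Qed.

Lemma fin_eq_oo x : (fin x == oo) = false.
Proof. by rewrite eq_sym (negPf (neq_lift _ _)). Qed.

Lemma fin_eq x y : (fin x == fin y) = (x == y).
Proof. by rewrite (inj_eq (@lift_inj _ _)). Qed.

Lemma fin_caseP i : i != oo -> exists x, i = fin x.
Proof. by case: (unliftP oo i) => [x -> _|->]; [exists x | rewrite eqxx]. Qed.

Lemma even_ab i j : i != fin j -> con [set a i; b (fin j)] (a i) (b (fin j)).
Proof.
move=> ij; apply: connect1; apply/andP; split; first exact: adj_ab.
by rewrite /layered_label /= fin_eq_oo.
Qed.

Lemma even_ab_oo i : con [set a (fin i); a oo] (a (fin i)) (b oo).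
Proof.
apply: connect1; apply/andP; split; first by rewrite adj_ab // fin_eq_oo.
by rewrite /layered_label /= eqxx.
Qed.

Lemma even_ac x k : x != k ->
  con [set a (fin x); a (fin (k + k - x))] (a (fin x)) (c (fin k)).
Proof.
move=> xk; apply: connect1; apply/andP; split.
  by rewrite adj_sym adj_ca // fin_eq eq_sym.
by rewrite /layered_label /= !fin_eq_oo !finK.
Qed.

Lemma even_ac_oo x : con [set a (fin x); b (fin x)] (a (fin x)) (c oo).
Proof.
apply: connect1; apply/andP; split.
  by rewrite adj_sym adj_ca // eq_sym fin_eq_oo.
by rewrite /layered_label /= eqxx.
Qed.

Lemma even_aoo_c k : con [set a oo; a (fin (k + u))] (a oo) (c (fin k)).
Proof.
apply: connect1; apply/andP; split.
  by rewrite adj_sym adj_ca // fin_eq_oo.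
by rewrite /layered_label /= fin_eq_oo eqxx finK.
Qed.

Lemma even_bd x k : x != k ->
  con [set b (fin x); b (fin (k + k - x))] (b (fin x)) (d (fin k)).
Proof.
move=> xk; apply: connect1; apply/andP; split.
  by rewrite adj_bd // fin_eq.
by rewrite /layered_label /= !fin_eq_oo !finK.
Qed.

Lemma even_bd_oo x : con [set a (fin x); b (fin x)] (b (fin x)) (d oo).
Proof.
apply: connect1; apply/andP; split.
  by rewrite adj_bd // fin_eq_oo.
by rewrite /layered_label /= fin_eq_oo eqxx.
Qed.

Lemma even_boo_d k : con [set a oo; a (fin k)] (b oo) (d (fin k)).
Proof.
apply: connect1; apply/andP; split.
  by rewrite adj_bd // eq_sym fin_eq_oo.
by rewrite /layered_label /= eqxx.
Qed.

(* The hypotheses are the parts of the routing that depend on the length of the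
   cycle. *)
Lemma even_routing :
  (forall x, con [set a oo; a (fin x)] (a oo) (d (fin x))) ->
  (forall x, con [set a (fin x); b (fin x)] (c oo) (d oo)) ->
  clique_routing (branch m oo) lab.
Proof.
move=> around_oo around.
have labC x y : lab x y = lab y x := layered_labelC even_orient x y.
have symC e := connect_labelledC e labC.
(* The path reaches [d (fin x)] by hypothesis and goes on through [b oo]. *)
have aoo x : con [set a oo; a (fin x)] (a oo) (a (fin x)).
  apply: connect_trans (around_oo x) _; rewrite symC.
  by apply: connect_trans (even_boo_d x); rewrite setUC even_ab_oo.
apply: branch_routing => [i j|i j j_oo|i j].
- have [->|/fin_caseP[x ->]] := eqVneq i oo.
    by rewrite eq_sym => /fin_caseP[y ->].
  have [-> _|/fin_caseP[y ->]] := eqVneq j oo; first by rewrite symC setUC.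
  rewrite fin_eq => /(ord_midpoint p_even)[k [kk xk yk]].
  apply: (connect_trans (y := c (fin k))).
    by have := even_ac xk; rewrite kk addrAC subrr add0r.
  by rewrite symC setUC; have := even_ac yk; rewrite kk addrK.
- have [x ->] := fin_caseP j_oo.
  have [->|/even_ab//] := eqVneq i (fin x).
  apply: connect_trans (even_ac_oo x) _; apply: connect_trans (around x) _.
  by rewrite symC even_bd_oo.
- move=> /fin_caseP[x ->] /fin_caseP[y ->].
  rewrite fin_eq => /(ord_midpoint p_even)[k [kk xk yk]].
  apply: (connect_trans (y := d (fin k))).
    by have := even_bd xk; rewrite kk addrAC subrr add0r.
  by rewrite symC setUC; have := even_bd yk; rewrite kk addrK.
Qed.

End EvenRouting.

(** * Even r on cycles of length 3 and 4 *)

(** Since c and d coincide, [c oo] already is [d oo], and with shift 0 a single edge leads from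
    [a oo] to [d (fin x)]. *)
Lemma even_routing3 p : ~~ odd p ->
  clique_routing (branch 0 (@ord_max p.+1))
    (layered_label (@even_orient 0 p 0%R)).
Proof.
move=> p_even.
have cd i : vc 0 i = vd 0 i :> cycle_complete 3 p.+2.
  by congr pair; apply: val_inj.
apply: even_routing => // x; rewrite -!cd ?connect0 //.
by have := @even_aoo_c 0 p 0%R x; rewrite addr0.
Qed.

Lemma even_routing4 p (u : 'I_p.+1) : ~~ odd p -> u != 0%R ->
  clique_routing (branch 1 (@ord_max p.+1))
    (layered_label (@even_orient 1 p u)).
Proof.
move=> p_even u0; set lab := layered_label _.
have labC x y : lab x y = lab y x := layered_labelC _ x y.
have adj_dc (i j : 'I_p.+2) : i != j -> adj (vd 1 i) (vc 1 j).
  by move=> ij; apply/andP; split=> //; apply: cycle_adj_succ.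
(* In odd order [u] differs from its opposite. This keeps the edges from [d] at [x - u] to [c] at
   [x] apart from those from [d] at [x + u] to [c] at [x], which serve [a oo]. *)
have uN : (- u != u)%R.
  apply: contra u0 => /eqP uNu; apply/eqP; apply: (ord_double_inj p_even).
  by rewrite /= -{1}uNu addNr addr0.
apply: even_routing => // x.
- have := @even_aoo_c 1 p u (x - u)%R; rewrite subrK => /connect_trans; apply.
  rewrite connect_labelledC //; apply: connect1; apply/andP; split.
    by rewrite adj_dc // fin_eq -subr_eq0 opprB addrC subrK.
  by rewrite /lab /layered_label /= !fin_eq_oo !finK subrK eqxx.
- apply: (connect_trans (y := vd 1 (lift ord_max (x - u)%R))).
    rewrite connect_labelledC //; apply: connect1; apply/andP; split.
      by rewrite adj_dc // fin_eq_oo.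
    by rewrite /lab /layered_label /= eqxx fin_eq_oo finK subrK.
  apply: (connect_trans (y := vc 1 (lift ord_max x))).
    apply: connect1; apply/andP; split.
      by rewrite adj_dc // fin_eq -subr_eq0 addrAC subrr add0r oppr_eq0.
    rewrite /lab /layered_label /= !fin_eq_oo !finK.
    by rewrite (inj_eq (addrI x)) (negPf uN).
  rewrite connect_labelledC //; apply: connect1; apply/andP; split.
    by rewrite adj_dc // eq_sym fin_eq_oo.
  by rewrite /lab /layered_label /= eqxx.
Qed.

(** With a single finite index there is no nonzero shift. The vertices [a], [b], [d], [c] form a
    4-cycle, and [a] and [d] are joined through [c]. *)
Lemma routing_4_2 : exists (B : {set cycle_complete 4 2}) lab,
  #|B| = 3 /\ clique_routing B lab.
Proof.
pose a := va 1 (ord0 : 'I_2); pose b := vb 1 (ord_max : 'I_2).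
pose d := vd 1 (ord0 : 'I_2); pose c := vc 1 (ord_max : 'I_2).
pose lab (x y : cycle_complete 4 2) : {set cycle_complete 4 2} :=
  if (x == c) || (y == c) then [set a; d] else [set x; y].
have labC x y : lab x y = lab y x by rewrite /lab orbC [ [set x; y] ]setUC.
have ab : connect (labelled lab [set a; b]) a b.
  by apply: connect1; apply/andP; split; first exact: adj_ab.
have bd : connect (labelled lab [set b; d]) b d.
  by apply: connect1; apply/andP; split; first exact: adj_bd.
have ad : connect (labelled lab [set a; d]) a d.
  rewrite connect_labelledC //; apply: (connect_trans (y := c)).
    by apply: connect1; apply/andP; rewrite /lab [c == c]eqxx orbT.
  by apply: connect1; apply/andP; rewrite /lab [c == c]eqxx.
exists [set a; b; d], lab; split.
  by rewrite setUC cardsU1 cards2 !inE.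
split=> // x y; rewrite !inE.
case/orP=> [/orP[]|] /eqP ->; case/orP=> [/orP[]|] /eqP -> // _;
  by rewrite connect_labelledC // setUC.
Qed.

(** * Both bounds combined *)

Theorem theorem25 (m r : nat) (hm : 3 <= m) (hr : 0 < r) :
  immersion_number (direct_product (cycle_graph m) (complete_graph r))
  = 2 * r - 1.
Proof.
set G := direct_product _ _.
have [im_G max_im] := immersion_numberP G.
apply/eqP; rewrite eqn_leq; apply/andP; split.
  case: (immersion_number G) im_G => [//|t] im_t.
  have := immersion_degree_bound (@cycle_complete_degree m r) im_t; lia.
suff [B [lab [<- rB]]] : exists (B : {set G}) lab,
    #|B| = 2 * r - 1 /\ clique_routing B lab.
  exact: max_im (routing_immersion rB).
have [r_odd|r_even] := boolP (odd r).
  case: r hr r_odd @G {im_G max_im} => // p _ p_even.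
  case: m hm => [|[|[|m]]] // _.
  exists (branch m ord0), (layered_label (@odd_orient m p)).
  by split; [exact: card_branch | exact: odd_routing].
have {hr} [p rE p_even] : exists2 p, r = p.+2 & ~~ odd p.
  exists r.-2; case: r hr r_even {G im_G max_im} => [|[|p]] //= _.
  by rewrite negbK.
(* For even r it suffices to route on the cycle of length 3 or 4 with the parity of [m]. *)
suff [m0 [k [m0_gt2 mE [B [lab [cardB rB]]]]]] :
    exists m0 k, [/\ 2 < m0, m = k.*2 + m0 & exists (B : {set cycle_complete m0 r}) lab,
      #|B| = 2 * r - 1 /\ clique_routing B lab].
  have [B' [lab' [cardB' rB']]] := routing_cycle_add_even k m0_gt2 rB.
  by rewrite /G mE; exists B', lab'; rewrite cardB' cardB.
move: rE {G im_G max_im r_even} => ->.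
have [m_odd|m_even] := boolP (odd m).
  exists 3, (m - 3)./2; split=> //; first by lia.
  exists (branch 0 (@ord_max p.+1)), (layered_label (@even_orient 0 p 0%R)).
  by split; [exact: card_branch | exact: even_routing3].
exists 4, (m - 4)./2; split=> //; first by lia.
case: p p_even => [_|p p_even]; first exact: routing_4_2.
exists (branch 1 ord_max).
(* Any nonzero shift would do; [ord_max] is one because at least two finite indices remain. *)
exists (layered_label (@even_orient 1 p.+1 (ord_max : 'I_p.+2))).
by split; [exact: card_branch | exact: even_routing4].
Qed.
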